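(* For a prime $q$, an integer $k\ge 1$, $j\in\mathbb{F}_q^*$ and a positive integer $N$, let $E_k(N;j,q)$ denote the number of quadruples $(b_1,b_2,b_3,b_4)\in\mathbb{F}_q^4$ such that $$b_1+b_2=b_3+b_4\quad\text{and}\quad b_i^k\in\{j,2j,\ldots,Nj\}\subseteq\mathbb{F}_q,\qquad i=1,2,3,4.$$ Then for a fixed $k\ge 3$ and any positive integers $Q\ge N\ge 1$, we have $$ \frac{\log Q}{Q}\sum_{\substack{Q/2\le q<Q\\ q\ \text{prime}}}\ \max_{j\in\mathbb{F}_q^*}E_k(N;j,q)\ll N^2+N^4Q^{-1+o(1)}. $$
   Context: $\mathbb{F}_q$ is the field of $q$ elements, $q$ prime; integers are viewed in $\mathbb{F}_q$ by reduction modulo $q$, so $\{j,2j,\ldots,Nj\}$ is a subset of $\mathbb{F}_q$. $U\ll V$ means $|U|\le cV$ for some positive constant $c$, which may depend on $k$. For a quantity $V>1$, $V^{o(1)}$ (as $V\to\infty$) denotes a function $U$ of $V$ satisfying $|U|\le V^{\varepsilon}$ for every $\varepsilon>0$, provided $V$ is large enough in terms of $\varepsilon$ (and the fixed $k$); the bound is uniform over all $N\le Q$. *)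

(* Defs.v *)
From HB Require Import structures.
From mathcomp Require Import all_boot all_order all_algebra.
From mathcomp Require Import all_classical all_reals all_analysis.

Set Implicit Arguments.
Unset Strict Implicit.
Unset Printing Implicit Defensive.

Import Order.TTheory GRing.Theory Num.Theory.
Local Open Scope ring_scope.

Definition first_multiples (q : nat) (N : nat) (j : 'F_q) : {set 'F_q} :=
  [set n.+1%:R * j | n : 'I_N].

Definition energy (k N q : nat) (j : 'F_q) : nat :=
  #|[set b : 'F_q * 'F_q * 'F_q * 'F_q |
      let: (b1, b2, b3, b4) := b in
      [&& b1 + b2 == b3 + b4,
          b1 ^+ k \in first_multiples N j, b2 ^+ k \in first_multiples N j,
          b3 ^+ k \in first_multiples N j & b4 ^+ k \in first_multiples N j]]|.

(* [U V] is a quantity of the form V^{o(1)} as V tends to infinity. *)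
Definition pow_o1 (R : realType) (U : nat -> R) : Prop :=
  forall eps : R, 0 < eps -> \forall V \near \oo%classic, `|U V| <= V%:R `^ eps.

(* Main.v *)
(* There is an integer form F(m1,m2,m3,m4), vanishing modulo q as soon as some k-th roots xi of mi
   in characteristic q satisfy x1 + x2 = x3 + x4: the determinant of the operator
   X1 + X2 - X3 - X4 on the tensor product of the algebras Z[Xi]/(Xi^k - mi).  Dividing
   the bi by a k-th root of j in an algebraic closure of F_q shows that, whatever j is, the energy
   is at most k^4 times the number of m in [1,N]^4 with q | F(m).

   If F(m) <> 0, then log |F(m)| = O(log Q), so F(m) has only O(1) prime divisors q >= Q/2;
   these m contribute O(N^4) in total.  The m with F(m) = 0 are counted for all of the
   O(Q / log Q) primes, so it remains to show that there are O(N^2) of them.  Such an m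
   has complex roots with x1 + x2 = x3 + x4.  If all the xi / x1 are rational, then the mi all
   lie in m1 times the k-th powers of rationals, and such a class has O(N^(1/3)) elements up to
   N, as k >= 3.
   Otherwise a Galois automorphism moves some xi / x1 and gives a second relation
   w1 x1 + w2 x2 = w3 x3 + w4 x4, where the wi are k-th roots of unity, not all equal:
   two of the mi are then determined by the other two and by the roots of unity involved. *)
Require Import Defs.
From HB Require Import structures.
From mathcomp Require Import all_boot all_order all_algebra.
From mathcomp Require Import zify ring lra.
From mathcomp Require Import all_fingroup all_field mxtens mxred spectral.
From mathcomp Require Import all_classical all_reals all_analysis.

Set Implicit Arguments.
Unset Strict Implicit.
Unset Printing Implicit Defensive.

Import Order.TTheory GRing.Theory Num.Theory.
Local Open Scope ring_scope.

(** * Galois conjugation of algebraic numbers *)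

(** The roots of the minimal polynomial of [x] generate a Galois extension of the rationals. An
    element fixed by its whole Galois group is rational, and every automorphism of this number field
    extends to [algC]. *)
Lemma irrational_moved_by_aut (x : algC) :
  x \notin Crat -> exists nu : {rmorphism algC -> algC}, nu x != x.
Proof.
move=> xNrat; have [rs Drs] := closed_field_poly_normal (minCpoly x).
rewrite (monicP (minCpoly_monic x)) scale1r in Drs.
have [Qn [QnC [s Ds genQn]]] := num_field_exists rs.
have [q [Dq _] _] := minCpolyP x.
have Dqs : map_poly (in_alg Qn) q = \prod_(z <- s) ('X - z%:P).
  apply: (map_poly_inj QnC); rewrite -map_poly_comp rmorph_prod /=.
  rewrite (eq_map_poly (g := ratr)) => [|a]; last by rewrite /= -in_algE fmorph_eq_rat fmorph_rat.
  rewrite -Dq Drs -Ds big_map; apply: eq_bigr => z _.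
  by rewrite rmorphB /= map_polyX map_polyC.
have Qq : map_poly (in_alg Qn) q \is a polyOver 1%AS.
  by apply/polyOverP => i; rewrite coef_map /= rpredZ ?rpred1.
have splitq : splittingFieldFor 1 (map_poly (in_alg Qn) q) {:Qn}.
  by exists s; rewrite ?Dqs ?eqpxx.
have Qn_ax : FieldExt_isSplittingField _ Qn.
  by constructor; exists (map_poly (in_alg Qn) q).
pose L := HB.pack_for (splittingFieldType rat) Qn Qn_ax.
have galL : galois 1 {:L}.
  apply/and3P; split; first exact: sub1v.
    apply/separableP => y _; apply: pcharf0_separable.
    by move=> p; rewrite (pchar_lalg L) pchar_num.
  by apply/splitting_normalField; [exact: sub1v | exists (map_poly (in_alg Qn) q)].
have /mapP[y sy Dx] : x \in map QnC s.
  by rewrite Ds -root_prod_XsubC -Drs root_minCpoly.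
have [/'forall_implyP/= fixy | ] := boolP [forall g, (g \in 'Gal({:L} / 1)%g) ==> (g y == y :> L)].
  case/negP: xNrat; have : (y : L) \in (1%AS : {vspace L}).
    rewrite -(galois_fixedField galL); apply/fixedFieldP; first exact: memvf.
    by move=> g gG; apply/eqP; exact: fixy.
  case/vlineP => a Dy; rewrite Dx Dy -in_algE fmorph_eq_rat fmorph_rat; exact: Crat_rat.
rewrite negb_forall => /existsP[g]; rewrite negb_imply => /andP[_ gy].
have [nu Dnu] := extend_algC_subfield_aut (QnC : {rmorphism L -> algC}) g.
by exists nu; rewrite Dx -Dnu fmorph_eq.
Qed.

(** * Kronecker sums and their eigenvalues *)

Definition kron_sum (R : pzRingType) m n (A : 'M[R]_m) (B : 'M[R]_n) : 'M[R]_(m * n) :=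
  A *t 1%:M + 1%:M *t B.

Lemma eigenvalue_det (F : fieldType) n (A : 'M[F]_n) a :
  eigenvalue A a = (\det (A - a%:M) == 0).
Proof.
apply/eigenvalueP/det0P => -[v]; first move=> vA v0.
  by exists v => //; rewrite mulmxBr vA mul_mx_scalar subrr.
move=> v0 /eqP; rewrite mulmxBr mul_mx_scalar subr_eq0 => /eqP vA.
by exists v.
Qed.

Lemma eigenvalue_dim_gt0 (F : fieldType) n (A : 'M[F]_n) a :
  eigenvalue A a -> (0 < n)%N.
Proof.
case/eigenvalueP => v _; case: n A v => // A v.
by rewrite [v]thinmx0 eqxx.
Qed.

Lemma tens1mx1 (R : pzRingType) m n : (1%:M : 'M[R]_m) *t (1%:M : 'M[R]_n) = 1%:M.
Proof.
apply/matrixP => i j; rewrite -(mxtens_unindexK i) -(mxtens_unindexK j).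
rewrite !mxE !mxtens_indexK (can_eq (@mxtens_indexK _ _)) xpair_eqE.
by case: eqP; case: eqP; rewrite /= ?mulr0 ?mul0r ?mulr1.
Qed.

Lemma tensZmx (R : comPzRingType) m n p q a (A : 'M[R]_(m, n)) (B : 'M[R]_(p, q)) :
  (a *: A) *t B = a *: (A *t B).
Proof. by apply/matrixP => i j; rewrite !mxE mulrA. Qed.

Lemma tensmxZ (R : comPzRingType) m n p q a (A : 'M[R]_(m, n)) (B : 'M[R]_(p, q)) :
  A *t (a *: B) = a *: (A *t B).
Proof. by apply/matrixP => i j; rewrite !mxE mulrCA. Qed.

Lemma tensBmx (R : pzRingType) m n p q (A A' : 'M[R]_(m, n)) (B : 'M[R]_(p, q)) :
  (A - A') *t B = A *t B - A' *t B.
Proof. by apply/matrixP => i j; rewrite !mxE mulrBl. Qed.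

Lemma tensmxB (R : pzRingType) m n p q (A : 'M[R]_(m, n)) (B B' : 'M[R]_(p, q)) :
  A *t (B - B') = A *t B - A *t B'.
Proof. by apply/matrixP => i j; rewrite !mxE mulrBr. Qed.

(** If [A - a] is invertible, so is its tensor product with the identity. *)
Lemma eigenvalue_tensmx1 (F : fieldType) m n (A : 'M[F]_m) a :
  eigenvalue (A *t (1%:M : 'M[F]_n)) a -> eigenvalue A a.
Proof.
move=> Aa; have := eigenvalue_dim_gt0 Aa; rewrite muln_gt0 !lt0n => /andP[m0 n0].
apply: contraLR Aa; rewrite !eigenvalue_det -!unitfE -!unitmxE => Aa.
suff -> : A *t 1%:M - a%:M = (A - a%:M) *t (1%:M : 'M[F]_n).
  by rewrite tensmx_unit ?unitmx1.
by rewrite -(scalemx1 (m * n) a) -(scalemx1 m a) tensBmx tensZmx tens1mx1.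
Qed.

Lemma eigenvalue_tens1mx (F : fieldType) m n (A : 'M[F]_n) a :
  eigenvalue ((1%:M : 'M[F]_m) *t A) a -> eigenvalue A a.
Proof.
move=> Aa; have := eigenvalue_dim_gt0 Aa; rewrite muln_gt0 !lt0n => /andP[m0 n0].
apply: contraLR Aa; rewrite !eigenvalue_det -!unitfE -!unitmxE => Aa.
suff -> : 1%:M *t A - a%:M = (1%:M : 'M[F]_m) *t (A - a%:M).
  by rewrite tensmx_unit ?unitmx1.
by rewrite -(scalemx1 (m * n) a) -(scalemx1 n a) tensmxB tensmxZ tens1mx1.
Qed.

Lemma tensmx_neq0 (F : fieldType) m n (v : 'rV[F]_m) (w : 'rV[F]_n) :
  v != 0 -> w != 0 -> (v *t w : 'rV_(m * n)) != 0.
Proof.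
move=> /rV0Pn[i vi] /rV0Pn[j wj]; apply/rV0Pn; exists (mxtens_index (i, j)).
by rewrite mxE mxtens_indexK !ord1 mulf_neq0.
Qed.

Lemma eigenvalue_kron_sum (F : fieldType) m n (A : 'M[F]_m) (B : 'M[F]_n) a b :
  eigenvalue A a -> eigenvalue B b -> eigenvalue (kron_sum A B) (a + b).
Proof.
move=> /eigenvalueP[v vA v0] /eigenvalueP[w wB w0].
apply/eigenvalueP; exists (v *t w); last exact: tensmx_neq0.
rewrite mulmxDr (tensmx_mul v w) (tensmx_mul v w) !mulmx1 vA wB.
by rewrite tensZmx tensmxZ scalerDl.
Qed.

(** The restrictions of [A] and [B] to [E] still commute, so they share an eigenvector, which is
    then carried back to the whole space. *)
Lemma stable_common_eigenvector (C : numClosedFieldType) n (E A B : 'M[C]_n) :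
    E != 0 -> stablemx E A -> stablemx E B -> comm_mx A B ->
  exists a b, exists2 v : 'rV_n, v != 0 & [/\ (v <= E)%MS, v *m A = a *: v & v *m B = b *: v].
Proof.
move=> E0 EA EB AB.
have rAB : comm_mx (restrictmx E A) (restrictmx E B).
  by rewrite /comm_mx -!conjmxM ?inE ?stablemx_row_base ?AB.
have [|v v0 /andP[vA vB]] := common_eigenvector2 _ rAB; first by rewrite lt0n mxrank_eq0.
rewrite !stablemx_restrict // in vA vB.
have /sub_rVP[a va] := vA; have /sub_rVP[b vb] := vB.
exists a, b; exists (v *m row_base E); first by rewrite mulmx_free_eq0 ?row_base_free.
by split=> //; rewrite mulmx_sub ?eq_row_base.
Qed.

(** The two summands commute with each other, hence preserve the eigenspace of [c]. On a common
    eigenvector inside it they act by scalars [a] and [b], whose sum must be [c]. *)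
Lemma eigenvalue_kron_sumP (C : numClosedFieldType) m n (A : 'M[C]_m) (B : 'M[C]_n) c :
  eigenvalue (kron_sum A B) c ->
  exists a b, [/\ eigenvalue A a, eigenvalue B b & a + b = c].
Proof.
move=> ABc; set E := eigenspace (kron_sum A B) c.
set X := A *t (1%:M : 'M[C]_n); set Y := (1%:M : 'M[C]_m) *t B.
have XY : comm_mx X Y.
  by rewrite /comm_mx (tensmx_mul A 1%:M) (tensmx_mul 1%:M B) !mulmx1 !mul1mx.
have XE : stablemx E X.
  by apply: comm_mx_stable_eigenspace; rewrite /comm_mx mulmxDl mulmxDr -/X -/Y XY.
have YE : stablemx E Y.
  by apply: comm_mx_stable_eigenspace; rewrite /comm_mx mulmxDl mulmxDr -/X -/Y XY.
have [a [b [v v0 [vE vX vY]]]] := stable_common_eigenvector ABc XE YE XY.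
exists a, b; split.
- by apply: (@eigenvalue_tensmx1 _ _ n); apply/eigenvalueP; exists v.
- by apply: (@eigenvalue_tens1mx _ m n); apply/eigenvalueP; exists v.
have /eigenspaceP := vE; rewrite mulmxDr -/X -/Y vX vY -scalerDl => /eqP.
by rewrite -subr_eq0 -scalerBl scaler_eq0 (negPf v0) orbF subr_eq0 => /eqP.
Qed.

Lemma map_kron_sum (aR rR : comPzRingType) (f : {rmorphism aR -> rR}) m n
    (A : 'M[aR]_m) (B : 'M[aR]_n) :
  map_mx f (kron_sum A B) = kron_sum (map_mx f A) (map_mx f B).
Proof. by rewrite /kron_sum map_mxD !map_mxT !map_mx1. Qed.

Lemma eigenvalueN (F : fieldType) n (A : 'M[F]_n) a :
  eigenvalue (- A) (- a) = eigenvalue A a.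
Proof.
apply/idP/idP => /eigenvalueP[v vA v0]; apply/eigenvalueP; exists v => //.
  by move/eqP: vA; rewrite mulmxN scaleNr eqr_opp => /eqP.
by rewrite mulmxN vA scaleNr.
Qed.

Lemma kron_sum_entry_le (R : numDomainType) m n (A : 'M[R]_m) (B : 'M[R]_n) a b :
    (forall i j, `|A i j| <= a) -> (forall i j, `|B i j| <= b) ->
  forall i j, `|kron_sum A B i j| <= a + b.
Proof.
move=> Aa Bb i j; rewrite !mxE (le_trans (ler_normD _ _)) // lerD // normrM normr_nat.
  apply: le_trans (Aa (mxtens_unindex i).1 (mxtens_unindex j).1).
  by rewrite ler_piMr // lern1 leq_b1.
apply: le_trans (Bb (mxtens_unindex i).2 (mxtens_unindex j).2).
by rewrite ler_piMl // lern1 leq_b1.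
Qed.

Lemma norm_det_le (R : numDomainType) n (A : 'M[R]_n) b :
  (forall i j, `|A i j| <= b) -> `|\det A| <= n`!%:R * b ^+ n.
Proof.
move=> Ab; rewrite /determinant (le_trans (ler_norm_sum _ _ _)) //.
rewrite -card_Sn -sum1_card natr_sum mulr_suml.
rewrite [X in _ <= X](eq_bigl predT) //; apply: ler_sum => s _; rewrite mul1r.
rewrite normrM normrX normrN1 expr1n mul1r normr_prod.
rewrite -[n in b ^+ n]card_ord -prodr_const; apply: ler_prod => i _.
by rewrite normr_ge0 Ab.
Qed.

(** * The integer form that detects additive relations between k-th roots *)

(** Multiplication by X on Z[X]/(X^k - a). Being an integer matrix, it can be reduced into any
    field, where its eigenvalues are the k-th roots of [a]. *)
Definition radical_mx (k : nat) (a : int) := companionmx ('X^k - a%:P : {poly int}).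

Lemma radical_mx_dim k a : (0 < k)%N -> (size ('X^k - a%:P : {poly int})).-1 = k.
Proof. by move=> k0; rewrite size_XnsubC. Qed.

Lemma radical_mx_entry_le k a (b : int) :
  (0 < k)%N -> 1 <= b -> `|a| <= b -> forall i j, `|radical_mx k a i j| <= b.
Proof.
move=> k0 b1 ab i j; rewrite mxE; case: ifP => _; last first.
  by rewrite normr_nat (le_trans _ b1) // lern1 leq_b1.
have jk : (j < k)%N by have := ltn_ord j; rewrite [X in (_ < X)%N]radical_mx_dim.
rewrite coefB coefXn coefC ltn_eqF //= sub0r opprK.
by case: eqP => // _; rewrite normr0 (le_trans _ b1).
Qed.

Lemma eigenvalue_radical_mx (F : fieldType) k a (c : F) : (0 < k)%N ->
  eigenvalue (map_mx intr (radical_mx k a)) c = (c ^+ k == a%:~R).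
Proof.
move=> k0; rewrite eigenvalue_root_char -map_char_poly companionmxK ?monicXnsubC //.
by rewrite rmorphB /= map_polyXn map_polyC /root hornerD hornerN hornerXn hornerC subr_eq0.
Qed.

Definition radical_sum_mx (k : nat) (m1 m2 m3 m4 : int) :=
  kron_sum (kron_sum (radical_mx k m1) (radical_mx k m2))
           (kron_sum (- radical_mx k m3) (- radical_mx k m4)).

(* Up to sign, the product of [x1 + x2 - x3 - x4] over all choices of k-th roots [xi] of [mi]. *)
Definition radical_norm k m1 m2 m3 m4 : int := \det (radical_sum_mx k m1 m2 m3 m4).

(** The entry bounds of the four companion matrices add up under Kronecker sums, and the Leibniz
    expansion in dimension k^4 does the rest. The hypothesis [1 <= b] covers the entries 1 of a
    companion matrix. *)
Lemma radical_norm_le k (m1 m2 m3 m4 b : int) : (0 < k)%N -> 1 <= b ->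
    `|m1| <= b -> `|m2| <= b -> `|m3| <= b -> `|m4| <= b ->
  `|radical_norm k m1 m2 m3 m4| <= (k ^ 4)`!%:R * (b *+ 4) ^+ (k ^ 4).
Proof.
move=> k0 b1 mb1 mb2 mb3 mb4; have radb := radical_mx_entry_le k0 b1.
have le_b i j : `|radical_sum_mx k m1 m2 m3 m4 i j| <= b *+ 4.
  rewrite (mulrnDr b 2 2) /radical_sum_mx.
  apply: kron_sum_entry_le => {i j}; apply: kron_sum_entry_le => i j;
    by rewrite ?[(- _ : matrix _ _ _) _ _]mxE ?normrN radb.
have := norm_det_le le_b; rewrite -/(radical_norm k m1 m2 m3 m4) !radical_mx_dim //.
by rewrite (_ : (k * k * (k * k) = k ^ 4)%N) // !expnS expn0 muln1 !mulnA.
Qed.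

(** Here x1 + x2 - x3 - x4 = 0 is an eigenvalue of the matrix. The field is arbitrary, so that this
    applies in characteristic q. *)
Lemma radical_norm_eq0 (F : fieldType) k m1 m2 m3 m4 (x1 x2 x3 x4 : F) : (0 < k)%N ->
    x1 + x2 = x3 + x4 ->
    x1 ^+ k = m1%:~R -> x2 ^+ k = m2%:~R -> x3 ^+ k = m3%:~R -> x4 ^+ k = m4%:~R ->
  (radical_norm k m1 m2 m3 m4)%:~R = 0 :> F.
Proof.
move=> k0 x1234 xm1 xm2 xm3 xm4.
have rad x m : x ^+ k = m%:~R -> eigenvalue (map_mx intr (radical_mx k m)) (x : F).
  by move=> xm; rewrite eigenvalue_radical_mx ?xm.
have radN x m : x ^+ k = m%:~R -> eigenvalue (map_mx intr (- radical_mx k m)) (- x : F).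
  by move=> xm; rewrite map_mxN eigenvalueN; apply: rad.
have : eigenvalue (map_mx intr (radical_sum_mx k m1 m2 m3 m4)) (x1 + x2 + (- x3 + - x4) : F).
  by rewrite !map_kron_sum !eigenvalue_kron_sum ?rad ?radN.
by rewrite eigenvalue_det -opprD x1234 subrr raddf0 subr0 det_map_mx => /eqP.
Qed.

(** A singular matrix has the eigenvalue 0, which splits along the Kronecker sums into eigenvalues
    of the four companion matrices. *)
Lemma radical_normP (C : numClosedFieldType) k m1 m2 m3 m4 : (0 < k)%N ->
    radical_norm k m1 m2 m3 m4 = 0 ->
  exists x1 x2 x3 x4 : C, [/\ x1 ^+ k = m1%:~R, x2 ^+ k = m2%:~R, x3 ^+ k = m3%:~R,
    x4 ^+ k = m4%:~R & x1 + x2 = x3 + x4].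
Proof.
move=> k0 N0.
have : eigenvalue (map_mx intr (radical_sum_mx k m1 m2 m3 m4)) (0 : C).
  by rewrite eigenvalue_det raddf0 subr0 det_map_mx [\det _]N0.
rewrite !map_kron_sum !map_mxN.
case/eigenvalue_kron_sumP => a [b [/eigenvalue_kron_sumP[x1 [x2 [x1E x2E <-]]]]].
case/eigenvalue_kron_sumP => [x3 [x4 [x3E x4E <-]]] x0.
exists x1, x2, (- x3), (- x4); rewrite -[x3]opprK -[x4]opprK !eigenvalueN in x3E x4E.
rewrite !eigenvalue_radical_mx // in x1E x2E x3E x4E.
by split; try exact/eqP; apply/eqP; rewrite -subr_eq0 opprD !opprK addrA -x0 addrA.
Qed.

(** * Conjugate relations, and counting solutions of two linear relations *)

(** If an automorphism [nu] moves g j / g i0, take w i = nu (g i) / g i. These are k-th roots of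
    unity because [nu] fixes the integers [m i], and applying [nu] to the given relation yields the
    new one. *)
Lemma second_relation (I : finType) (i0 : I) k (s : I -> int) (m : I -> nat) (g : I -> algC) :
    (0 < k)%N -> (forall i, (0 < m i)%N) -> (forall i, g i ^+ k = (m i)%:R) ->
    \sum_i (s i)%:~R * g i = 0 ->
  (forall i, g i / g i0 \in Crat) \/
  exists (w : I -> algC) (j : I), [/\ forall i, w i ^+ k = 1, w j != w i0
    & \sum_i (s i)%:~R * w i * g i = 0].
Proof.
move=> k0 m0 gm sg0.
have g0 i : g i != 0.
  by apply: contraTneq (m0 i) => gi0; move: (gm i); rewrite gi0 expr0n gtn_eqF // => /esym/eqP;
    rewrite pnatr_eq0 => /eqP ->.
have [/forallP allQ|] := boolP [forall i, g i / g i0 \in Crat]; first by left.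
rewrite negb_forall => /existsP[j /irrational_moved_by_aut[nu nuj]]; right.
exists (fun i => nu (g i) / g i), j; split.
- by move=> i; rewrite expr_div_n -rmorphXn gm rmorph_nat divff // pnatr_eq0 -lt0n.
- apply: contraNneq nuj => /eqP; rewrite fmorph_div.
  rewrite eqr_div // => /eqP eq_ij; rewrite eqr_div ?fmorph_eq0 //.
  by rewrite eq_ij mulrC.
- suff -> : \sum_i (s i)%:~R * (nu (g i) / g i) * g i = nu (\sum_i (s i)%:~R * g i).
    by rewrite sg0 rmorph0.
  rewrite rmorph_sum; apply: eq_bigr => i _.
  by rewrite rmorphM rmorph_int -mulrA divfK.
Qed.

(** The 2 by 2 minor of the relations at [i] and [j] is nonzero, so the values of [m] there are
    determined by its values at the other indices. *)
Lemma two_relations_card (F : fieldType) (I : finType) N (f : 'I_N -> F) (a b : I -> F) (i j : I) :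
    injective f -> a i * b j != a j * b i ->
  (#|[set m : {ffun I -> 'I_N} |
       ((\sum_x a x * f (m x) == 0) && (\sum_x b x * f (m x) == 0))%R]| <= N ^ (#|I| - 2))%N.
Proof.
move=> f_inj ab; set S := [set m | _].
have ij : i != j by apply: contraNneq ab => ->.
pose J := {x : I | x \notin [set i; j]}.
pose restr (m : {ffun I -> 'I_N}) : {ffun J -> 'I_N} := [ffun x => m (val x)].
have restr_inj : {in S &, injective restr}.
  move=> m m'; rewrite !inE => /andP[/eqP am /eqP bm] /andP[/eqP am' /eqP bm'] /ffunP rmm'.
  have mm' x : x != i -> x != j -> m x = m' x.
    move=> xi xj; have xJ : x \notin [set i; j] by rewrite !inE negb_or xi.
    by have := rmm' (Sub x xJ); rewrite !ffunE.
  have diff c : \sum_x c x * f (m x) = 0 -> \sum_x c x * f (m' x) = 0 ->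
      c i * (f (m i) - f (m' i)) + c j * (f (m j) - f (m' j)) = 0.
    move=> cm cm'.
    transitivity (\sum_x c x * f (m x) - \sum_x c x * f (m' x)); last by rewrite cm cm' subrr.
    rewrite -sumrB (bigD1 i) //= (bigD1 j) 1?eq_sym //= big1 ?addr0 => [|x /andP[xi xj]].
      by rewrite !mulrBr.
    by rewrite mm' // subrr.
  have := diff a am am'; have := diff b bm bm'.
  set u := f (m i) - _; set v := f (m j) - _ => bE aE.
  (* Cramer's rule: both differences vanish after multiplication by the minor. *)
  have ab0 : a i * b j - a j * b i != 0 by rewrite subr_eq0.
  have u0 : u = 0.
    apply: (mulfI ab0); rewrite mulr0.
    have -> : (a i * b j - a j * b i) * u = b j * (a i * u + a j * v) - a j * (b i * u + b j * v).
      by ring.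
    by rewrite aE bE !mulr0 subrr.
  have v0 : v = 0.
    apply: (mulfI ab0); rewrite mulr0.
    have -> : (a i * b j - a j * b i) * v = a i * (b i * u + b j * v) - b i * (a i * u + a j * v).
      by ring.
    by rewrite aE bE !mulr0 subrr.
  apply/ffunP => x; have [->|xi] := eqVneq x i.
    by apply: f_inj; apply/eqP; rewrite -subr_eq0 -/u u0.
  have [->|xj] := eqVneq x j; last exact: mm'.
  by apply: f_inj; apply/eqP; rewrite -subr_eq0 -/v v0.
rewrite -(card_in_imset restr_inj) (leq_trans (max_card _)) //.
rewrite card_ffun card_ord card_sig leq_eqVlt; apply/orP; left; apply/eqP; congr (_ ^ _)%N.
have := cardsC [set i; j]; rewrite cards2 ij => <-.
by rewrite addKn; apply: eq_card => x; rewrite !inE.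
Qed.

(** * Integers whose quotient is the k-th power of a rational *)

(** The relation x / y = (u / v)^k with denominators cleared. *)
Definition power_class (k x y : nat) :=
  exists u v : nat, [/\ (0 < u)%N, (0 < v)%N & (x * v ^ k = y * u ^ k)%N].

Lemma power_class_sym k x y : power_class k x y -> power_class k y x.
Proof. by case=> u [v [u0 v0 xy]]; exists v, u; split. Qed.

Lemma power_class_trans k x y z :
  power_class k x y -> power_class k y z -> power_class k x z.
Proof.
case=> u [v [u0 v0 xy]] [u' [v' [u'0 v'0 yz]]]; exists (u * u')%N, (v * v')%N.
rewrite !muln_gt0 u0 v0 u'0 v'0; split=> //.
by rewrite !expnMn (mulnA x) xy mulnAC yz -mulnA (mulnC (u' ^ k)%N).
Qed.

(** Put u / v in lowest terms: then v^k divides [y] by Gauss's lemma, and [t] is the quotient. *)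
Lemma power_class_coprime k x y : (0 < k)%N -> power_class k x y ->
  exists t u v : nat, [/\ (0 < u)%N, x = (t * u ^ k)%N & y = (t * v ^ k)%N].
Proof.
move=> k0 [u [v [u0 v0 xy]]]; pose g := gcdn u v.
have g0 : (0 < g)%N by rewrite gcdn_gt0 u0.
have uE : u = (u %/ g * g)%N by rewrite divnK // dvdn_gcdl.
have vE : v = (v %/ g * g)%N by rewrite divnK // dvdn_gcdr.
have uv' : coprime (v %/ g) (u %/ g).
  rewrite /coprime -(eqn_pmul2r g0) mul1n muln_gcdl -uE -vE gcdnC.
  exact/eqP.
have u'0 : (0 < u %/ g)%N by move: u0; rewrite {1}uE muln_gt0 => /andP[].
have v'0 : (0 < v %/ g)%N by move: v0; rewrite {1}vE muln_gt0 => /andP[].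
set u' := (u %/ g)%N in uE uv' u'0; set v' := (v %/ g)%N in vE uv' v'0.
have {}xy : (x * v' ^ k = y * u' ^ k)%N.
  apply/eqP; rewrite -(@eqn_pmul2r (g ^ k)%N) ?expn_gt0 ?g0 //.
  by rewrite -!mulnA -!expnMn -uE -vE xy.
have : (v' ^ k %| y)%N.
  rewrite -(@Gauss_dvdl _ _ (u' ^ k)%N) ?coprimeXl ?coprimeXr //.
  by rewrite -xy dvdn_mull.
case/dvdnP => t yE; exists t, u', v'; split=> //.
apply/eqP; rewrite -(@eqn_pmul2r (v' ^ k)%N) ?expn_gt0 ?v'0 //.
by rewrite xy yE mulnAC.
Qed.

(* [x^(1/k)] and [y^(1/k)] are distinct integer multiples of a common number [t^(1/k) >= 1],
   and cube roots are even further apart. *)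
Lemma power_class_cbrt_inj k c x y :
    (3 <= k)%N -> (0 < x)%N -> (0 < y)%N -> power_class k x y ->
    (c ^ 3 <= x < c.+1 ^ 3)%N -> (c ^ 3 <= y < c.+1 ^ 3)%N -> x = y.
Proof.
move=> k3; wlog : x y / (x <= y)%N.
  move=> W x0 y0 xy xc yc; have [xley|/ltnW ylex] := leqP x y; first exact: W.
  by apply/esym; apply: W => //; exact: power_class_sym.
rewrite leq_eqVlt => /predU1P[//|xy] x0 y0 /(power_class_coprime (ltnW (ltnW k3))).
case=> t [u [v [u0 xE yE]]] /andP[cx xc] /andP[cy yc]; exfalso.
have t0 : (0 < t)%N by move: x0; rewrite xE muln_gt0 => /andP[].
have uv : (u < v)%N.
  rewrite ltnNge; apply/negP => vu; move: xy; rewrite xE yE ltnNge leq_mul2l.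
  by rewrite leq_exp2r ?vu ?orbT // (ltnW (ltnW k3)).
(* If u > c, then x >= u^k >= (c + 1)^3, a contradiction. *)
have [cu|uc] := ltnP c u.
  move: xc; rewrite ltnNge (leq_trans (_ : _ <= u ^ 3)%N) ?leq_exp2r //.
  rewrite xE (leq_trans (_ : _ <= u ^ k)%N) ?leq_pexp2l //.
  by rewrite leq_pmull.
have c0 : (0 < c)%N by exact: leq_trans uc.
(* This says (1 + 1/c)^3 <= (1 + 1/u)^k, which holds since u <= c and 3 <= k. As y >= t (u + 1)^k,
   it forces y >= (c + 1)^3. *)
have key : (u ^ k * c.+1 ^ 3 <= c ^ 3 * u.+1 ^ k)%N.
  have [d kE] : exists d, k = (3 + d)%N by exists (k - 3)%N; rewrite subnKC.
  rewrite kE !expnD (mulnAC (u ^ 3)%N) mulnA; apply: leq_mul.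
    by rewrite -!expnMn leq_exp2r //; nia.
  by case: (d) => [|d']; rewrite ?expn0 // leq_exp2r.
have : (c ^ 3 * (t * u.+1 ^ k) < c ^ 3 * c.+1 ^ 3)%N.
  rewrite ltn_pmul2l ?expn_gt0 ?c0 // (leq_ltn_trans _ yc) // yE leq_mul2l.
  by rewrite leq_exp2r ?uv ?orbT // (ltnW (ltnW k3)).
apply/negP; rewrite -leqNgt mulnCA (leq_trans (_ : _ <= x * c.+1 ^ 3)%N) ?leq_mul2r ?cx ?orbT //.
by rewrite xE -mulnA leq_mul2l key orbT.
Qed.

Lemma cbrt_exists n : exists c, (c ^ 3 <= n < c.+1 ^ 3)%N.
Proof.
have ex : exists c, (c ^ 3 <= n)%N by exists 0%N.
have ub c : (c ^ 3 <= n)%N -> (c <= n)%N.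
  by move=> cn; apply: leq_trans cn; case: c => // c; rewrite -[leqLHS]expn1 leq_pexp2l.
case: (ex_maxnP ex ub) => c cn max_c; exists c; rewrite cn ltnNge.
by apply/negP => /max_c; rewrite ltnn.
Qed.

(** Once the entry at [(false, false)] is fixed, each of the three others is determined by the
    integer part of its cube root, which takes O(N^(1/3)) values. *)
Lemma same_power_class_card k N (A : {set {ffun bool * bool -> 'I_N}}) : (3 <= k)%N ->
    (forall m, m \in A -> forall i, power_class k (m i).+1 (m (false, false)).+1) ->
  (#|A| <= 8 * N ^ 2)%N.
Proof.
move=> k3 Acl; have cb n := sigW (cbrt_exists n).
pose f n := sval (cb n); have fP n : (f n ^ 3 <= n < (f n).+1 ^ 3)%N by exact: svalP (cb n).
have f_le n : (n <= N)%N -> (f n < (f N).+1)%N.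
  move=> nN; have /andP[fn _] := fP n; have /andP[_ fN] := fP N.
  by rewrite -(@ltn_exp2r _ _ 3) // (leq_ltn_trans fn) // (leq_ltn_trans nN).
have [N0|N0] := posnP N.
  by subst N; rewrite (leq_trans (max_card _)) // card_ffun card_ord card_prod card_bool.
pose h (i : 'I_N) := Ordinal (f_le i.+1 (ltn_ord i)).
pose code (m : {ffun bool * bool -> 'I_N}) :=
  (m (false, false), h (m (false, true)), h (m (true, false)), h (m (true, true))).
have h_inj (i j : 'I_N) : power_class k i.+1 j.+1 -> h i = h j -> i = j.
  move=> ij /(congr1 val) /= hij; apply/val_inj; apply: succn_inj.
  by apply: (power_class_cbrt_inj (c := f i.+1)) ij _ _ => //; rewrite ?fP // hij fP.
have code_inj : {in A &, injective code}.
  move=> m m' mA m'A [mm' e1 e2 e3]; apply/ffunP.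
  have cl p : power_class k (m p).+1 (m' p).+1.
    apply: power_class_trans (Acl m mA p) _; rewrite mm'.
    by apply: power_class_sym; exact: Acl.
  by case=> -[] [] //; apply: h_inj => //; apply: val_inj.
have /andP[fN _] := fP N; have f1 : (0 < f N)%N.
  by have /andP[_] := fP N; case: (f N) => //; rewrite exp1n ltnS leqNgt N0.
rewrite -(card_in_imset code_inj) (leq_trans (max_card _)) // !card_prod !card_ord.
(* With c = f N >= 1, (c + 1)^3 <= 8 c^3 <= 8 N: this is the constant 8. *)
have : ((f N).+1 ^ 3 <= (2 * f N) ^ 3)%N by rewrite leq_exp2r //; lia.
by rewrite expnMn !expnS !expn0 in fN *; nia.
Qed.

(** * Counting the zeros of the form *)

Lemma sum_bool2 (V : nmodType) (F : bool * bool -> V) :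
  \sum_p F p = F (false, false) + F (false, true) + (F (true, false) + F (true, true)).
Proof.
rewrite (eq_bigr (fun p => F (p.1, p.2))) => [|[]//].
by rewrite -(pair_bigA _ (fun b c => F (b, c))) /= !big_bool /= addrC [_ + F (false, false)]addrC
  [F (true, true) + _]addrC.
Qed.

(* The index [(b, _)] is on the left of x1 + x2 = x3 + x4 iff [b] is [false]; [i : 'I_N] stands for
   the integer [i + 1]. *)
Definition radical_norm_at k N (m : {ffun bool * bool -> 'I_N}) : int :=
  radical_norm k (m (false, false)).+1 (m (false, true)).+1
    (m (true, false)).+1 (m (true, true)).+1.

Lemma Crat_power_class k x y (z : algC) :
  (0 < x)%N -> (0 < y)%N -> z \in Crat -> z ^+ k * y%:R = x%:R -> (0 < k)%N -> power_class k x y.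
Proof.
move=> x0 y0 /CratP[q ->] zE k0; pose u := `|numq q|%N; pose v := `|denq q|%N.
have v0 : (0 < v)%N by rewrite absz_gt0 denq_neq0.
have E : (x * v ^ k = y * u ^ k)%N.
  (* Absolute values discard the sign of [q]. *)
  have : `|ratr q : algC| ^+ k * y%:R = x%:R.
    by rewrite -normrX -[y%:R in LHS]normr_nat -normrM zE normr_nat.
  have -> : `|ratr q : algC| = u%:R / v%:R.
    rewrite -[in LHS](divq_num_den q) fmorph_div !rmorph_int normf_div.
    by rewrite -!intr_norm -!abszE -!pmulrn.
  move=> E; apply/eqP; rewrite -(eqr_nat algC) !natrM !natrX -E expr_div_n.
  have vk0 : (v%:R : algC) ^+ k != 0 by rewrite expf_neq0 // pnatr_eq0 -lt0n.
  by rewrite mulrAC (divfK vk0) mulrC.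
exists u, v; split=> //.
rewrite lt0n; apply/negP => /eqP u0; move: E; rewrite u0 exp0n // muln0 => /eqP.
by rewrite muln_eq0 expn_eq0 !gtn_eqF.
Qed.

Lemma card_bigcup_le (T I : finType) (P : pred I) (F : I -> {set T}) b :
  (forall i, P i -> #|F i| <= b)%N -> (#|\bigcup_(i | P i) F i| <= #|P| * b)%N.
Proof.
move=> Fb; rewrite -sum_nat_const; apply: (@leq_trans (\sum_(i | P i) #|F i|)); last exact: leq_sum.
elim/big_rec2: _ => [|i n U Pi nU]; first by rewrite cards0.
by rewrite (leq_trans (leq_card_setU _ _)) // leq_add2l.
Qed.

(** Complex roots of m p are written as z^(e p) times the fixed root [rt (m p)], so the unknowns of
    both relations are the values of [rt], and the coefficients depend only on the pair of exponent
    vectors [(e, e')]. There are k^4 * k^4 such pairs; the term 8 comes from the rational case. *)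
Lemma radical_norm_zeros_card k N : (3 <= k)%N ->
  (#|[set m : {ffun bool * bool -> 'I_N} | radical_norm_at k m == 0%R]|
     <= ((k ^ 4) * (k ^ 4) + 8) * N ^ 2)%N.
Proof.
move=> k3; have k0 : (0 < k)%N by exact: leq_trans k3.
have [z prim_z] := C_prim_root_exists k0.
pose rt (i : 'I_N) : algC := k.-root i.+1%:R.
have rtE i : rt i ^+ k = i.+1%:R by exact: rootCK.
have rt0 i : rt i != 0.
  by have := expf_eq0 (rt i) k; rewrite rtE pnatr_eq0 k0 /= => <-.
have rt_inj : injective rt.
  move=> i j ij; have := rtE i; rewrite ij rtE => /eqP; rewrite eqr_nat eqSS.
  by move/eqP => ji; apply: val_inj.
pose s (p : bool * bool) : int := (-1) ^+ p.1.
pose E := {ffun bool * bool -> 'I_k}.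
pose a (e : E) p : algC := (s p)%:~R * z ^+ e p.
pose b (e e' : E) p : algC := a e p * z ^+ e' p.
have a0 e p : a e p != 0.
  by rewrite mulf_neq0 ?expf_neq0 ?intr_eq0 ?signr_eq0 // (prim_root_eq0 prim_z) -lt0n.
pose S (ee : E * E) := [set m : {ffun bool * bool -> 'I_N} |
   (\sum_p a ee.1 p * rt (m p) == 0) && (\sum_p b ee.1 ee.2 p * rt (m p) == 0)%R].
pose P (ee : E * E) := [exists p, ee.2 p != ee.2 (false, false)].
have cardS ee : P ee -> (#|S ee| <= N ^ 2)%N.
  case/existsP => j ej.
  rewrite (leq_trans (two_relations_card (i := j) (j := (false, false)) rt_inj _)) //.
    (* After cancelling the coefficients [a], the minor is nonzero because z^(e' j) differs from
       z^(e' (false, false)). *)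
    rewrite /b mulrCA !(inj_eq (mulfI (a0 _ _))).
    by rewrite eq_sym (eq_prim_root_expr prim_z) !modn_small.
  by rewrite card_prod card_bool.
set Z := [set m | _].
pose A := [set m in Z | `[< forall i, power_class k (m i).+1 (m (false, false)).+1 >]].
have ZAS : Z \subset (\bigcup_(ee | P ee) S ee) :|: A.
  apply/fintype.subsetP => m mZ; rewrite finset.in_setU [m \in A]inE mZ /=.
  move: (mZ); rewrite inE => /eqP /(radical_normP algC k0)[x1 [x2 [x3 [x4]]]].
  case=> x1m x2m x3m x4m x1234.
  pose g p := match p with (false, false) => x1 | (false, true) => x2
    | (true, false) => x3 | (true, true) => x4 end.
  have gm p : g p ^+ k = (m p).+1%:R by case: p => -[] [].
  have sg0 : \sum_p (s p)%:~R * g p = 0.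
    by rewrite sum_bool2 /= !rmorph1 !mul1r !mulN1r x1234 -opprD subrr.
  have g_div_rt p : (g p / rt (m p)) ^+ k = 1.
    by rewrite expr_div_n gm rtE divff ?pnatr_eq0.
  case: (second_relation (false, false) (m := fun p => (m p).+1) k0 _ gm sg0) => //.
    move=> gQ; apply/orP; right; apply/asboolP => p.
    apply: Crat_power_class (gQ p) _ k0 => //.
    by rewrite expr_div_n !gm divfK ?pnatr_eq0.
  case=> w [j [wk wj wg0]]; apply/orP; left.
  pose e := [ffun p => sval (prim_rootP prim_z (g_div_rt p))] : E.
  pose e' := [ffun p => sval (prim_rootP prim_z (wk p))] : E.
  have ae p : a e p * rt (m p) = (s p)%:~R * g p.
    by rewrite /a ffunE -(svalP (prim_rootP prim_z (g_div_rt p))) -mulrA divfK.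
  have we p : z ^+ e' p = w p by rewrite ffunE -(svalP (prim_rootP prim_z (wk p))).
  apply/finset.bigcupP; exists (e, e').
    by apply/existsP; exists j; apply: contraNneq wj => /= ej; rewrite -!we ej.
  rewrite inE; apply/andP; split; apply/eqP.
    by rewrite -[RHS]sg0; apply: eq_bigr => p _; rewrite ae.
  by rewrite -[RHS]wg0; apply: eq_bigr => p _; rewrite /b mulrAC ae we /= mulrAC.
rewrite (leq_trans (subset_leq_card ZAS)) // (leq_trans (leq_card_setU _ _)) //.
rewrite mulnDl leq_add //.
  rewrite (leq_trans (card_bigcup_le cardS)) // leq_mul2r (leq_trans (max_card _)) ?orbT //.
  by rewrite card_prod !card_ffun card_ord card_prod card_bool.
by apply: same_power_class_card k3 _ => m; rewrite inE => /andP[_ /asboolP].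
Qed.

(** * From the energy to divisibility of the form *)

Lemma card_power_roots_le (F : finFieldType) k (a : F) :
  (0 < k)%N -> (#|[set b : F | b ^+ k == a]| <= k)%N.
Proof.
move=> k0; rewrite -ltnS -(size_XnsubC a k0) cardE.
apply: max_poly_roots (enum_uniq _); first by rewrite -size_poly_gt0 size_XnsubC.
apply/allP => b; rewrite mem_enum inE => /eqP ba.
by rewrite /root hornerD hornerN hornerXn hornerC ba subrr.
Qed.

Lemma dvdn_radical_norm q k (j b1 b2 b3 b4 : 'F_q) (m1 m2 m3 m4 : nat) :
    prime q -> (0 < k)%N -> j != 0 -> b1 + b2 = b3 + b4 ->
    b1 ^+ k = m1%:R * j -> b2 ^+ k = m2%:R * j -> b3 ^+ k = m3%:R * j -> b4 ^+ k = m4%:R * j ->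
  (q %| `|radical_norm k m1 m2 m3 m4|)%N.
Proof.
move=> q_pr k0 j0 b1234 bm1 bm2 bm3 bm4.
have [K [f _]] := countable_algebraic_closure ('F_q).
(* [j] need not be a k-th power in F_q, but it is one in the algebraic closure; dividing by [t]
   removes [j] from all four equations. *)
have [t tj] : exists t : K, t ^+ k = f j.
  have [|t] := @closed_rootP K ('X^k - (f j)%:P) _; first by rewrite size_XnsubC // eqSS -lt0n.
  by rewrite /root hornerD hornerN hornerXn hornerC subr_eq0 => /eqP; exists t.
have root_div b (m : nat) : b ^+ k = m%:R * j -> (f b / t) ^+ k = m%:~R.
  move=> bm; rewrite expr_div_n -rmorphXn bm rmorphM rmorph_nat tj mulfK //.
  by rewrite fmorph_eq0.
have : (radical_norm k m1 m2 m3 m4)%:~R = 0 :> K.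
  apply: (radical_norm_eq0 (x1 := f b1 / t) (x2 := f b2 / t) (x3 := f b3 / t)
    (x4 := f b4 / t)) => //; do ?exact: root_div.
  by rewrite -!mulrDl -!rmorphD b1234.
have qK : q \in [pchar K] by rewrite (fmorph_pchar f) pchar_Fp.
by rewrite (dvdn_pcharf qK); case: radical_norm => n /eqP; rewrite ?NegzE ?rmorphN ?oppr_eq0.
Qed.

(** Each quadruple is covered by some [m] of multipliers, and each [m] covers at most k^4
    quadruples. Multipliers may fail to be unique when N >= q, so this is a covering and not a
    partition. *)
Lemma energy_le q k N (j : 'F_q) : prime q -> (0 < k)%N -> j != 0 ->
  (energy k N j <=
   k ^ 4 * #|[set m : {ffun bool * bool -> 'I_N} | q %| `|radical_norm_at k m| ]|)%N.
Proof.
move=> q_pr k0 j0; set T := [set m | _]; rewrite /energy; set E := (X in (#|X| <= _)%N).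
pose rts (i : 'I_N) := [set b : 'F_q | b ^+ k == i.+1%:R * j].
pose R (m : {ffun bool * bool -> 'I_N}) :=
  finset.setX (finset.setX (finset.setX (rts (m (false, false))) (rts (m (false, true))))
    (rts (m (true, false)))) (rts (m (true, true))).
have sub : E \subset \bigcup_(m in T) R m.
  apply/fintype.subsetP => -[[[b1 b2] b3] b4]; rewrite inE => /and5P[/eqP b1234].
  move=> /imsetP[m1 _ bm1] /imsetP[m2 _ bm2] /imsetP[m3 _ bm3] /imsetP[m4 _ bm4].
  pose mf (p : bool * bool) : 'I_N := match p with (false, false) => m1 | (false, true) => m2
    | (true, false) => m3 | (true, true) => m4 end.
  pose m : {ffun bool * bool -> 'I_N} := [ffun p => mf p].
  apply/finset.bigcupP; exists m; last by rewrite !inE !ffunE bm1 bm2 bm3 bm4 !eqxx.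
  rewrite inE /radical_norm_at !ffunE.
  exact: dvdn_radical_norm b1234 bm1 bm2 bm3 bm4.
rewrite (leq_trans (subset_leq_card sub)) // mulnC card_bigcup_le // => m _.
by rewrite !cardsX !expnS expn0 muln1 !mulnA !leq_mul ?card_power_roots_le.
Qed.

(** * Primes between Q/2 and Q *)

Lemma dvdn_prod_primes M (s : seq nat) : uniq s ->
  {in s, forall q, prime q && (q %| M)%N} -> (\prod_(q <- s) q %| M)%N.
Proof.
elim: s => [|p s IH] /=; first by rewrite big_nil dvd1n.
case/andP=> ps s_uniq sP; rewrite big_cons.
have /andP[p_pr pM] := sP p (mem_head _ _).
have sM : (\prod_(q <- s) q %| M)%N by apply: IH => // q qs; apply: sP; rewrite inE qs orbT.
rewrite Gauss_dvd ?pM // big_seq.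
apply: (big_ind (coprime p)) => [|x y|q qs]; rewrite ?coprimen1 //.
  by rewrite coprimeMr => -> ->.
have /andP[q_pr _] : prime q && (q %| M)%N by apply: sP; rewrite inE qs orbT.
rewrite prime_coprime // dvdn_prime2 //; by apply: contraNneq ps => ->.
Qed.

Lemma expn_size_primes_le b M (s : seq nat) : (0 < M)%N -> uniq s ->
    {in s, forall q, [&& prime q, (b <= q)%N & (q %| M)%N]} ->
  (b ^ size s <= M)%N.
Proof.
move=> M0 s_uniq sP; apply: (@leq_trans (\prod_(q <- s) q)); last first.
  by rewrite dvdn_leq // dvdn_prod_primes // => q /sP /and3P[-> _ ->].
have sb : {in s, forall q, b <= q}%N by move=> q /sP /and3P[].
elim: s {s_uniq sP} sb => [|p s IH] sb; first by rewrite big_nil.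
rewrite big_cons /= expnS leq_mul ?sb ?mem_head //.
by apply: IH => q qs; apply: sb; rewrite inE qs orbT.
Qed.

Lemma bin_le n m : ('C(n, m) <= 2 ^ n)%N.
Proof.
have [nm|mn] := ltnP n m; first by rewrite bin_small.
rewrite -[2%N]/(1 + 1)%N expnDn (bigD1 (Ordinal (mn : (m < n.+1)%N))) //=.
by rewrite !exp1n !muln1 leq_addr.
Qed.

Lemma prime_dvd_fact p n : prime p -> (p %| n`!)%N -> (p <= n)%N.
Proof.
move=> p_pr; elim: n => [|n IH]; first by rewrite fact0 dvdn1; case: p p_pr => [|[]].
by rewrite factS Euclid_dvdM // => /orP[/dvdn_leq->|/IH/leqW].
Qed.

Lemma prime_dvd_central_bin p n : prime p -> (n < p <= n.*2)%N -> (p %| 'C(n.*2, n))%N.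
Proof.
move=> p_pr /andP[np p2n].
have : (p %| n.*2`!)%N by rewrite dvdn_fact // prime_gt0.
rewrite -(@bin_fact n.*2 n) -?addnn ?leq_addr // addnK !Euclid_dvdM //.
have /negPf -> : ~~ (p %| n`!)%N by apply/negP => /(prime_dvd_fact p_pr); rewrite leqNgt np.
by rewrite !orbF.
Qed.

Definition upper_half_primes Q := [seq q <- index_iota 0 Q | prime q & (Q <= 2 * q)%N].

Lemma mem_upper_half_primes Q q :
  (q \in upper_half_primes Q) = [&& prime q, (Q <= 2 * q)%N & (q < Q)%N].
Proof. by rewrite mem_filter mem_index_iota /= -andbA. Qed.

(** Every prime of the list is at least the base of the power. The maximum with 2 keeps that base
    above 1 for small [Q], so that exponents can be compared. *)
Lemma count_dvd_upper_half_primes Q M b : (0 < M)%N ->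
    (M <= maxn 2 (uphalf Q) ^ b)%N ->
  (count (fun q => q %| M)%N (upper_half_primes Q) <= b)%N.
Proof.
move=> M0 Mb; set q0 := maxn _ _ in Mb.
have q0_gt1 : (1 < q0)%N by rewrite leq_max.
rewrite -(leq_exp2l _ _ q0_gt1) -size_filter (leq_trans _ Mb) //.
apply: expn_size_primes_le => //; first by rewrite filter_uniq // filter_uniq // iota_uniq.
move=> q; rewrite mem_filter mem_upper_half_primes => /and4P[qM q_pr Qq _].
rewrite q_pr qM andbT geq_max prime_gt1 //=.
by rewrite leq_uphalf_double -mul2n.
Qed.

(** This trades powers of [Q] for powers of the lower bound on the primes, doubling the exponent. *)
Lemma leq_max_uphalf_sqr Q : (Q <= maxn 2 (uphalf Q) ^ 2)%N.
Proof.
apply: (@leq_trans (2 * uphalf Q)); first by lia.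
by rewrite expnS expn1 leq_mul // leq_max leqnn ?orbT.
Qed.

(** Chebyshev's upper bound in multiplicative form: primes in (n, 2n] divide the central binomial
    coefficient, which is at most 4^n. *)
Lemma upper_half_primes_chebyshev Q : (0 < Q)%N ->
  (Q ^ size (upper_half_primes Q) <= 64 ^ Q)%N.
Proof.
(* The extra factor [n] accounts for the possible prime q = n. *)
move=> Q0; set n := uphalf Q; set M := (n * 'C(n.*2, n))%N.
have n0 : (0 < n)%N by rewrite uphalf_gt0.
have Qn : (Q <= n.*2)%N by rewrite /n; lia.
have nQ : (n.*2 <= Q.+1)%N by rewrite /n; lia.
have M0 : (0 < M)%N by rewrite muln_gt0 n0 bin_gt0 -addnn leq_addr.
have dvdM q : q \in upper_half_primes Q -> (q %| M)%N.
  rewrite mem_upper_half_primes => /and3P[q_pr Qq qQ].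
  have : (n <= q)%N by rewrite /n leq_uphalf_double -mul2n.
  rewrite leq_eqVlt => /predU1P[<-|nq]; first exact: dvdn_mulr.
  by rewrite dvdn_mull // prime_dvd_central_bin // nq ltnW // (leq_trans qQ).
have M8 : (M <= 8 ^ Q)%N.
  rewrite (_ : 8 = 2 ^ 3)%N // -expnM (@leq_trans (2 ^ n * 2 ^ n.*2)%N) //.
    by rewrite leq_mul ?bin_le // ltnW // ltn_expl.
  by rewrite -expnD leq_exp2l // -addnn; lia.
have : (maxn 2 n ^ size (upper_half_primes Q) <= 8 ^ Q)%N.
  apply: leq_trans M8; apply: expn_size_primes_le => //; first by rewrite filter_uniq // iota_uniq.
  move=> q qQ; rewrite dvdM // andbT; move: qQ; rewrite mem_upper_half_primes => /and3P[q_pr Qq _].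
  by rewrite q_pr geq_max prime_gt1 //= /n leq_uphalf_double -mul2n.
(* Squaring passes from the base [maxn 2 n] to [Q], hence 64. *)
rewrite (_ : 64 = 8 ^ 2)%N // -expnM mulnC expnM => le8.
apply: (@leq_trans ((maxn 2 n ^ 2) ^ size (upper_half_primes Q))%N).
  by case: size => // r; rewrite leq_exp2r // leq_max_uphalf_sqr.
by rewrite -expnM mulnC expnM leq_exp2r.
Qed.

(** * Summation over the primes *)

(** With n = k^4 and q0 = [maxn 2 (uphalf Q)], the form is at most n! (4N)^n. Since n! <= q0^(n!)
    and 4N <= 4Q <= q0^4, this is at most q0 to the power n! + 4n. *)
Lemma count_dvd_radical_norm_le k N Q (m : {ffun bool * bool -> 'I_N}) :
    (0 < k)%N -> (0 < N <= Q)%N -> radical_norm_at k m != 0 ->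
  (count (fun q => q %| `|radical_norm_at k m|)%N (upper_half_primes Q)
    <= (k ^ 4)`! + 4 * k ^ 4)%N.
Proof.
move=> k0 /andP[N0 NQ] norm0; apply: count_dvd_upper_half_primes; first by rewrite absz_gt0.
set n := (k ^ 4)%N; set q0 := maxn _ _.
have q0_gt1 : (1 < q0)%N by rewrite leq_max.
have mN p : `|(m p).+1%:Z| <= N%:Z by rewrite ger0_norm // lez_nat.
have := radical_norm_le k0 (_ : 1 <= N%:Z) (mN (false, false)) (mN (false, true))
  (mN (true, false)) (mN (true, true)).
rewrite -/(radical_norm_at k m) => /(_ N0).
have -> : (k ^ 4)`!%:R * (N%:Z *+ 4) ^+ (k ^ 4) = (n`! * (4 * N) ^ n)%N%:Z.
  by rewrite -(mulr_natl N%:Z 4) -!natz natrM natrX natrM.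
rewrite -abszE lez_nat => /leq_trans -> //; rewrite expnD leq_mul //.
  exact: leq_trans (ltnW (ltn_expl _ q0_gt1)) _.
rewrite expnM leq_exp2r ?expn_gt0 ?k0 // (expnM _ 2 2).
rewrite (@leq_trans (2 ^ 2 * q0 ^ 2)%N) //.
  by rewrite leq_mul // (leq_trans NQ) // leq_max_uphalf_sqr.
by rewrite [leqRHS]expnS expn1 leq_mul2r leq_exp2r // q0_gt1 orbT.
Qed.

Lemma sum_max_energy_le k N Q : (3 <= k)%N -> (0 < N <= Q)%N ->
  (\sum_(0 <= q < Q | prime q && (Q <= 2 * q)%N) \max_(j : 'F_q | j != 0%R) energy k N j
    <= k ^ 4 * ((k ^ 4 * k ^ 4 + 8) * N ^ 2 * size (upper_half_primes Q)
                + N ^ 4 * ((k ^ 4)`! + 4 * k ^ 4)))%N.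
Proof.
move=> k3 NQ; have k0 : (0 < k)%N by exact: leq_trans k3.
set D := ((k ^ 4)`! + _)%N; set s := upper_half_primes Q.
pose M := {ffun bool * bool -> 'I_N}.
rewrite -big_filter -/(upper_half_primes Q) -/s.
apply: (@leq_trans (\sum_(q <- s) k ^ 4 * \sum_(m : M) (q %| `|radical_norm_at k m|))%N).
  rewrite big_seq [leqRHS]big_seq; apply: leq_sum => q.
  (* The bound on the energy does not depend on [j], so it bounds the maximum. *)
  rewrite mem_upper_half_primes => /andP[q_pr _]; apply/bigmax_leqP => j j0.
  rewrite (leq_trans (energy_le N q_pr k0 j0)) // leq_mul2l -sum1_card big_mkcond /=.
  by apply/orP; right; apply: leq_sum => m _; rewrite inE; case: (_ %| _)%N.
rewrite -big_distrr /= leq_mul2l exchange_big /=; apply/orP; right.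
apply: (@leq_trans (\sum_(m : M) ((radical_norm_at k m == 0%R) * size s + D))%N).
  apply: leq_sum => m _.
  have -> : (\sum_(q <- s) (q %| `|radical_norm_at k m|) =
      count (fun q => q %| `|radical_norm_at k m|) s)%N.
    by rewrite -sum1_count [RHS]big_mkcond; apply: eq_bigr => q _; case: (_ %| _)%N.
  have [_|norm0] := eqVneq (radical_norm_at k m) 0%R.
    by rewrite mul1n (leq_trans (count_size _ _)) // leq_addr.
  by rewrite mul0n count_dvd_radical_norm_le.
rewrite big_split /= -big_distrl /= leq_add //.
  rewrite leq_mul2r; apply/orP; right; apply: leq_trans (radical_norm_zeros_card N k3).
  by rewrite -sum1_card [leqRHS]big_mkcond; apply: leq_sum => m _; rewrite inE; case: eqP.
by rewrite sum_nat_const card_ffun card_ord card_prod card_bool.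
Qed.

(** * Logarithms and the final estimate *)

(** With L = ln x, x^eps = exp(eps L) >= 1 + (eps L)^2 / 2, which exceeds L as soon as L >= 2 /
    eps^2. *)
Lemma ln_le_powR (R : realType) (eps x : R) :
  0 < eps -> expR (2 / eps ^+ 2) <= x -> ln x <= x `^ eps.
Proof.
move=> e0 x_ge; have x0 : 0 < x by apply: lt_le_trans x_ge; exact: expR_gt0.
have L_ge : 2 / eps ^+ 2 <= ln x by rewrite -ler_expR lnK.
have L0 : 0 <= ln x by rewrite (le_trans _ L_ge) // divr_ge0 ?exprn_ge0 // ltW.
rewrite /powR gt_eqF //; apply: le_trans (expR_ge1Dxn 1 (mulr_ge0 (ltW e0) L0)).
rewrite ler_pdivrMr ?exprn_gt0 // in L_ge.
rewrite (_ : 2`!%:R = 2) // exprMn; nra.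
Qed.

Lemma pow_o1_ln (R : realType) : pow_o1 (fun n => ln n%:R : R).
Proof.
move=> eps e0; near=> V.
have V_ge : expR (2 / eps ^+ 2) <= V%:R :> R by near: V; exact: nbhs_infty_ger.
rewrite ger0_norm ?ln_le_powR // ln_ge0 // (le_trans _ V_ge) // -expR0 ler_expR.
by rewrite divr_ge0 ?exprn_ge0 // ltW.
Unshelve. all: by end_near. Qed.

Lemma size_upper_half_primes_ln (R : realType) Q : (0 < Q)%N ->
  (size (upper_half_primes Q))%:R * ln (Q%:R : R) <= Q%:R * ln 64.
Proof.
move=> Q0; rewrite !mulr_natl -!lnXn ?ltr0n // ler_ln ?posrE ?exprn_gt0 ?ltr0n //.
by rewrite -!natrX ler_nat upper_half_primes_chebyshev.
Qed.

Theorem theorem1p3 (R : realType) (k : nat) (hk : (3 <= k)%N) :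
  exists2 c : R, 0 < c & exists2 U : nat -> R, pow_o1 U &
    forall Q N : nat, (1 <= N)%N -> (N <= Q)%N ->
      `| ln Q%:R / Q%:R *
         \sum_(0 <= q < Q | prime q && (Q <= 2 * q)%N)
           (\max_(j : 'F_q | j != 0) energy k N j)%:R |
      <= c * (N%:R ^+ 2 + N%:R ^+ 4 * (Q%:R^-1 * U Q)).
Proof.
pose C := (k ^ 4 * k ^ 4 + 8)%N; pose D := ((k ^ 4)`! + 4 * k ^ 4)%N.
have ln64 : 0 < ln 64 :> R by rewrite ln_gt0 // ltr1n.
exists ((k ^ 4)%:R * (C%:R * ln 64 + D%:R)).
  rewrite mulr_gt0 ?ltr0n ?expn_gt0 ?(ltn_trans _ hk) //.
  by rewrite ltr_wpDr // mulr_gt0 // ltr0n addn_gt0 orbT.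
(* The factor Q^o(1) is just log Q, from the normalisation log Q / Q. *)
exists (fun n => ln n%:R); first exact: pow_o1_ln.
move=> Q N N1 NQ; have Q0 : (0 < Q)%N by exact: leq_trans NQ.
have Q0R : 0 < Q%:R :> R by rewrite ltr0n.
have lnQ : 0 <= ln Q%:R :> R by rewrite ln_ge0 // ler1n.
rewrite -natr_sum ger0_norm; last by rewrite mulr_ge0 // divr_ge0 // ltW.
have NQ' : (0 < N <= Q)%N by rewrite N1.
have := sum_max_energy_le hk NQ'; rewrite -/C -/D -(ler_nat R).
set S := (\sum_(_ <= _ < _ | _) _)%N => S_le.
set a := ln _ / _; have a0 : 0 <= a by rewrite divr_ge0 // ltW.
apply: le_trans (ler_wpM2l a0 S_le) _; set s := size _.
have sa : s%:R * a <= ln 64 by rewrite mulrA ler_pdivrMr // [leRHS]mulrC size_upper_half_primes_ln.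
have -> : ln Q%:R = a * Q%:R by rewrite divfK ?gt_eqF.
rewrite [Q%:R^-1 * _]mulrC mulfK ?gt_eqF // natrM mulrCA -mulrA ler_wpM2l //.
rewrite natrD (natrM R (C * N ^ 2)%N s) (natrM R C (N ^ 2)%N) (natrM R (N ^ 4)%N D) !natrX.
have Csa : C%:R * N%:R ^+ 2 * (s%:R * a) <= C%:R * N%:R ^+ 2 * ln 64 :> R.
  by rewrite ler_wpM2l // mulr_ge0 // exprn_ge0.
(* [r1] and [r2] are the cross terms in the expansion of (C ln 64 + D)(N^2 + N^4 a), where a = ln Q
   / Q. *)
have r1 : 0 <= D%:R * N%:R ^+ 2 :> R by rewrite mulr_ge0 // exprn_ge0.
have r2 : 0 <= C%:R * ln 64 * (N%:R ^+ 4 * a) :> R.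
  by rewrite !mulr_ge0 ?exprn_ge0 // ltW.
lra.
Qed.
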